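(* Let $K$ be a field of characteristic $p>0$ and set $$M_p=(X_1+X_2^{p-1},\,X_2+1),\qquad S_p=(X_2+X_1^{2p-1},\,X_1),\qquad G_p=S_p\circ M_p\circ S_p^{-1}\in\mathrm{GA}_2(K).$$ Then $G_p$ is tame, $G_p$ is not a quasi-translation, and $\tau_K(G_p)=|G_p|=p^2$.
   Context: $K[X]=K[X_1,\dots,X_n]$. $\mathrm{GA}_n(K)$ is the group of polynomial automorphisms of affine $n$-space over $K$: an element is a tuple $F=(F_1,\dots,F_n)\in K[X]^n$ that has a two-sided inverse in $K[X]^n$ under the composition $(F\circ G)_i=F_i\circ G=F_i(G_1,\dots,G_n)$; the identity is $\mathrm{Id}=(X_1,\dots,X_n)$. $|F|$ denotes the order of $F$ in this group. For $F\in K[X]^n$ let $\sigma_F\colon K[X]\to K[X]$, $\sigma_F(P)=P\circ F=P(F_1,\dots,F_n)$, and $\Delta_F=\sigma_F-\mathrm{Id}$, i.e. $\Delta_F(P)=P\circ F-P$. For $g\in K[X]$ the Pascal depth of $g$ with respect to $F$ is $\tau_K^F(g)=\min\{m\ge1:\Delta_F^m(g)=0\}$, with value $\infty$ if no such $m$ exists. Set $\tau_K(F)=\max_{1\le i\le n}\tau_K^F(X_i)$ (the Pascal depth of $F$). Affine automorphisms are the maps $X\mapsto AX+b$ with $A\in\mathrm{GL}_n(K)$, $b\in K^n$. An automorphism is elementary if, after a permutation of the coordinates, it has the form $(X_1+q(X_2,\dots,X_n),X_2,\dots,X_n)$ with $q\in K[X_2,\dots,X_n]$. An automorphism is tame if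 it lies in the subgroup of $\mathrm{GA}_n(K)$ generated by the affine and the elementary automorphisms. A polynomial automorphism $F=\mathrm{Id}+H$ with $H\in K[X]^n$ is a quasi-translation if $\mathrm{Id}-H$ is its inverse (equivalently, $H\circ F=H$). *)

(* Defs.v *)
From HB Require Import structures.
From mathcomp Require Import all_boot all_order all_algebra all_fingroup.
From mathcomp Require Import boolp.
From mathcomp.multinomials Require Export mpoly.

Set Implicit Arguments.
Unset Strict Implicit.
Unset Printing Implicit Defensive.

Import GRing.Theory.
Local Open Scope ring_scope.

(* Values in {0, 1, 2, ...} with a top element: [None] stands for infinity. *)
Definition enat := option nat.

Definition emax (a b : enat) : enat :=
  if a is Some m then if b is Some n then Some (maxn m n) else None else None.

Definition emin_pos (P : pred nat) : enat :=
  if pselect (exists m, (0 < m)%N && P m) is left ex then Some (ex_minn ex)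
  else None.

Section PolynomialMaps.
Variables (K : fieldType) (n : nat).

Definition polymap := n.-tuple {mpoly K[n]}.
Implicit Types (F G H : polymap) (g : {mpoly K[n]}).

Definition polymap_id : polymap := [tuple 'X_i | i < n].

Definition polymap_comp F G : polymap := [tuple (tnth F i) \mPo G | i < n].

Definition Delta F g : {mpoly K[n]} := g \mPo F - g.

Definition pascal_depth_at F g : enat := emin_pos (fun m => iter m (Delta F) g == 0).

Definition pascal_depth F : enat :=
  \big[emax/Some 0%N]_(i < n) pascal_depth_at F 'X_i.

Lemma tnth_polymap_comp F G i :
  tnth (polymap_comp F G) i = tnth F i \mPo G.
Proof. by rewrite tnth_mktuple. Qed.

Lemma comp_mpoly_polymap_comp g F G :
  (g \mPo F) \mPo G = g \mPo (polymap_comp F G).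
Proof.
rewrite (comp_mpolyEX g F) (comp_mpolyEX g (polymap_comp F G)) raddf_sum /=.
apply: eq_bigr => m _; rewrite comp_mpolyZ !comp_mpolyX rmorph_prod /=.
by congr (_ *: _); apply: eq_bigr => i _; rewrite tnth_polymap_comp rmorphXn.
Qed.

Lemma polymap_compA : associative polymap_comp.
Proof.
move=> F G H; apply: eq_from_tnth => i.
by rewrite !tnth_polymap_comp comp_mpoly_polymap_comp.
Qed.

Lemma polymap_comp1F : left_id polymap_id polymap_comp.
Proof.
move=> F; apply: eq_from_tnth => i.
by rewrite tnth_polymap_comp tnth_mktuple comp_mpolyXU -tnth_nth.
Qed.

Lemma polymap_compF1 : right_id polymap_id polymap_comp.
Proof.
by move=> F; apply: eq_from_tnth => i; rewrite tnth_polymap_comp comp_mpoly_id.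
Qed.

Definition inverse_maps (FG : polymap * polymap) : bool :=
  (polymap_comp FG.1 FG.2 == polymap_id) && (polymap_comp FG.2 FG.1 == polymap_id).

(* A polynomial automorphism is stored together with its two-sided inverse,
   which it determines (see [GA_inj]). *)
Record GA := MkGA { GA_pair : polymap * polymap; _ : inverse_maps GA_pair }.

HB.instance Definition _ := [isSub for GA_pair].
HB.instance Definition _ := [Choice of GA by <:].

Definition GA_map (F : GA) : polymap := (val F).1.

Lemma GA_mapV (F : GA) : polymap_comp (val F).1 (val F).2 = polymap_id.
Proof. by case: F => FG /= /andP[/eqP]. Qed.

Lemma GA_Vmap (F : GA) : polymap_comp (val F).2 (val F).1 = polymap_id.
Proof. by case: F => FG /= /andP[_ /eqP]. Qed.

Lemma GA_inj : injective GA_map.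
Proof.
move=> F G eqFG; apply: val_inj; move: eqFG (GA_Vmap F) (GA_mapV G).
rewrite /GA_map; case: (val F) (val G) => [f f'] [g g'] /= -> f'g gg'.
by rewrite -[f']polymap_compF1 -gg' polymap_compA f'g polymap_comp1F.
Qed.

Fact GA_one_subproof : inverse_maps (polymap_id, polymap_id).
Proof. by rewrite /inverse_maps /= polymap_comp1F eqxx. Qed.
Definition GA_one : GA := MkGA GA_one_subproof.

Fact GA_inv_subproof (F : GA) : inverse_maps ((val F).2, (val F).1).
Proof. by rewrite /inverse_maps /= GA_mapV GA_Vmap eqxx. Qed.
Definition GA_inv (F : GA) : GA := MkGA (GA_inv_subproof F).

Fact GA_mul_subproof (F G : GA) :
  inverse_maps (polymap_comp (val F).1 (val G).1, polymap_comp (val G).2 (val F).2).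
Proof.
rewrite /inverse_maps /= !polymap_compA.
rewrite -(polymap_compA (val F).1) GA_mapV polymap_compF1 GA_mapV eqxx.
by rewrite -(polymap_compA (val G).2) GA_Vmap polymap_compF1 GA_Vmap eqxx.
Qed.
Definition GA_mul (F G : GA) : GA := MkGA (GA_mul_subproof F G).

Fact GA_mulA : associative GA_mul.
Proof. by move=> F G H; apply: GA_inj; apply: polymap_compA. Qed.
Fact GA_mul1 : left_id GA_one GA_mul.
Proof. by move=> F; apply: GA_inj; apply: polymap_comp1F. Qed.
Fact GA_mulr1 : right_id GA_one GA_mul.
Proof. by move=> F; apply: GA_inj; apply: polymap_compF1. Qed.
Fact GA_mulV : left_inverse GA_one GA_inv GA_mul.
Proof. by move=> F; apply: GA_inj; apply: GA_Vmap. Qed.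
Fact GA_mulrV : right_inverse GA_one GA_inv GA_mul.
Proof. by move=> F; apply: GA_inj; apply: GA_mapV. Qed.

HB.instance Definition _ :=
  isGroup.Build GA GA_mulA GA_mul1 GA_mulr1 GA_mulV GA_mulrV.

Definition affine (F : GA) : Prop :=
  exists (A : 'M[K]_n) (b : 'I_n -> K), A \in unitmx /\
    forall i, tnth (GA_map F) i = \sum_(j < n) A i j *: 'X_j + (b i)%:MP.

(* [i] is the coordinate moved to the first place by the permutation; [q] is a
   polynomial in the other variables, i.e. 'X_i occurs in no monomial of [q]. *)
Definition elementary (F : GA) : Prop :=
  exists (i : 'I_n) (q : {mpoly K[n]}),
    (forall m, m \in msupp q -> m i = 0%N) /\
    forall j, tnth (GA_map F) j = if j == i then 'X_i + q else 'X_j.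

Definition quasi_translation (F : GA) : Prop :=
  exists H : polymap, forall i,
    tnth (GA_map F) i = 'X_i + tnth H i /\
    tnth (GA_map F^-1%g) i = 'X_i - tnth H i.

End PolynomialMaps.

Inductive generated (G : groupType) (S : G -> Prop) : G -> Prop :=
| generated_in x : S x -> generated S x
| generated_one : generated S 1%g
| generated_mul x y : generated S x -> generated S y -> generated S (x * y)%g
| generated_inv x : generated S x -> generated S x^-1%g.

Definition tame (K : fieldType) (n : nat) (F : GA K n) : Prop :=
  generated (fun E => affine E \/ elementary E) F.

Definition group_order (G : groupType) (x : G) : enat :=
  emin_pos (fun m => (x ^+ m)%g == 1%g).

Section TheAutomorphism.
Variables (K : fieldType) (p : nat).

Let X1 : {mpoly K[2]} := 'X_ord0.
Let X2 : {mpoly K[2]} := 'X_ord_max.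

Definition M_map : polymap K 2 := [tuple X1 + X2 ^+ p.-1; X2 + 1].
Definition M_inv_map : polymap K 2 := [tuple X1 - (X2 - 1) ^+ p.-1; X2 - 1].

Definition S_map : polymap K 2 := [tuple X2 + X1 ^+ (2 * p).-1; X1].
Definition S_inv_map : polymap K 2 := [tuple X2; X1 - X2 ^+ (2 * p).-1].

Let comp2 (a b : {mpoly K[2]}) (G : polymap K 2) :
  polymap_comp [tuple a; b] G = [tuple a \mPo G; b \mPo G].
Proof.
by apply/eq_from_tnth => i; rewrite tnth_mktuple; case: i => [[|[|]]].
Qed.

Let id2 : polymap_id K 2 = [tuple X1; X2].
Proof.
apply/eq_from_tnth => i; rewrite tnth_mktuple !(tnth_nth 0).
by case: i => [[|[|]]] //= ?; congr 'X_ _; apply: val_inj.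
Qed.

Let compXn (G : polymap K 2) (a : {mpoly K[2]}) k :
  (a ^+ k) \mPo G = (a \mPo G) ^+ k.
Proof. exact: rmorphXn. Qed.

Let compE := (comp_mpolyD, comp_mpolyN, comp_mpoly1, compXn, comp_mpolyXU).

Fact M_subproof : inverse_maps (M_map, M_inv_map).
Proof.
rewrite /inverse_maps /M_map /M_inv_map /= !comp2 id2.
rewrite /X1 /X2 !compE /=.
by apply/andP; split; apply/eqP/val_inj; rewrite /= !(addrK, subrK).
Qed.
Definition M_aut : GA K 2 := MkGA M_subproof.

Fact S_subproof : inverse_maps (S_map, S_inv_map).
Proof.
rewrite /inverse_maps /S_map /S_inv_map /= !comp2 id2.
rewrite /X1 /X2 !compE /=.
by apply/andP; split; apply/eqP/val_inj; rewrite /= !(addrK, subrK).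
Qed.
Definition S_aut : GA K 2 := MkGA S_subproof.

Definition G_aut : GA K 2 := (S_aut * M_aut * S_aut^-1)%g.

End TheAutomorphism.

(* Main.v *)
Require Import Defs.
From mathcomp Require Import all_boot all_algebra.
From mathcomp Require Import all_fingroup boolp.

Set Implicit Arguments.
Unset Strict Implicit.
Unset Printing Implicit Defensive.

Import GRing.Theory.
Local Open Scope ring_scope.

(** Write [s_F] for the substitution [g |-> g \mPo F], so that
    [Delta F = s_F - 1].

    Order and upper bound.  By induction, [M_p^k] sends [x] to
    [x + \sum_(i < k) (y + i)^(p-1)] and [y] to [y + k].  Since
    [\sum_(i < p) (y + i)^(p-1) = -1] in characteristic [p], the power
    [M_p^p] is the translation [(x - 1, y)], so [M_p], and with it its
    conjugate [G_p], has order [p^2].  The Frobenius identity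
    [(T - 1)^p = T^p - 1] then gives [Delta^(p^2) = s^(p^2) - 1 = 0], so no
    Pascal depth exceeds [p^2].

    Lower bound.  Likewise [(T - 1)^(p-1) = 1 + T + ... + T^(p-1)], so
    [Delta^(p^2-1)] is the trace over the cyclic group of order [p^2].
    Conjugation turns the trace of [x] under [G_p] into the trace under [M_p] of
    the first component [y + x^(2p-1)] of [S_p].  That trace is computed in two
    stages.  Summing over the translations [x |-> x - j] kills [y] and turns
    [x^(2p-1)] into [x - x^p - c], where [c] is the sum of the residues mod [p];
    this uses [(x - j)^(2p-1) = (x^p - j) (x - j)^(p-1)].  Summing the result
    over the first [p] powers of [M_p] gives [A - A^p], where [A] is the sum of
    the translation parts [\sum_(i < b) (y + i)^(p-1)], [b < p], namely
    [A = 1 - y - c].  Hence the trace is [y^p - y], which is not zero, and the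
    depth of [x] is exactly [p^2] ([iter_Delta_M], [iter_Delta_G_neq0]).

    A quasi-translation satisfies [Delta^2 = 0] on the variables, which is
    excluded because [2 <= p^2 - 1].  Tameness is visible from the factorizations
    of [M_p] and [S_p] into a shear and an affine map. *)

(** * Iterated differences in characteristic p *)

Section DifferenceOperator.
Variables (K : fieldType) (V : lmodType K) (s : {linear V -> V}).

(** [s - 1] is the action of ['X - 1] when [{poly K}] acts on [V] by ['X := s],
    so identities between powers of ['X - 1] transfer to iterated differences. *)
Lemma iter_diffE m g :
  iter m (fun h => s h - h) g =
  \sum_(i < m.+1) (('X - 1 : {poly K}) ^+ m)`_i *: iter i s g.
Proof.
elim: m => [|m IHm]; first by rewrite big_ord1 expr0 coef1 scale1r.
rewrite iterS IHm; set Q := ('X - 1) ^+ m.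
(* Padding with the zero coefficient of degree m.+1 aligns the two sums. *)
have Q0 : Q`_m.+1 = 0 by rewrite nth_default // size_exp_XsubC.
have -> : \sum_(i < m.+1) Q`_i *: iter i s g
          = \sum_(i < m.+2) Q`_i *: iter i s g.
  by rewrite [RHS]big_ord_recr /= Q0 scale0r addr0.
rewrite {1}big_ord_recr /= Q0 scale0r addr0 linear_sum /=.
under [RHS]eq_bigr => i _ do
  rewrite exprS -/Q mulrBl mul1r coefB coefXM scalerBl.
rewrite sumrB; congr (_ - _).
rewrite [RHS]big_ord_recl /= scale0r add0r.
by apply: eq_bigr => i _; rewrite linearZ.
Qed.

Variables (p : nat) (pcharKp : p \in [pchar K]).

(** [('X - 1)^p = 'X^p - 1], by Frobenius. *)
Lemma iter_diff_pchar g : iter p (fun h => s h - h) g = iter p s g - g.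
Proof.
have p_gt0 := prime_gt0 (pcharf_prime pcharKp).
rewrite iter_diffE -[1]/(1%:P).
have -> : ('X - 1%:P) ^+ p = 'X^p - 1 :> {poly K}.
  have pcharPp : p \in [pchar {poly K}] by rewrite pchar_poly.
  by rewrite -!(pFrobenius_autE pcharPp) rmorphB rmorph1.
under eq_bigr => i _ do rewrite coefB coefXn coef1 scalerBl.
rewrite sumrB big_ord_recr /= eqxx scale1r big1 ?add0r => [|i _]; last first.
  by rewrite ltn_eqF ?scale0r.
congr (_ - _); rewrite big_ord_recl /= scale1r big1 ?addr0 // => i _.
by rewrite scale0r.
Qed.

(** Cancelling ['X - 1] in [('X - 1)^p = 'X^p - 1] leaves the geometric sum: the
    last difference that can be nonzero is a trace. *)
Lemma iter_diff_pchar_pred g :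
  iter p.-1 (fun h => s h - h) g = \sum_(i < p) iter i s g.
Proof.
have p_gt0 := prime_gt0 (pcharf_prime pcharKp).
rewrite iter_diffE prednK //; apply: eq_bigr => i _.
have -> : ('X - 1) ^+ p.-1 = \sum_(j < p) 'X^j :> {poly K}.
  have pcharPp : p \in [pchar {poly K}] by rewrite pchar_poly.
  have X1 : ('X - 1 : {poly K}) != 0 by rewrite -size_poly_gt0 size_XsubC.
  apply: (mulfI X1); rewrite -exprS prednK // -subrX1.
  by rewrite -!(pFrobenius_autE pcharPp) rmorphB rmorph1.
rewrite coef_sum (bigD1 i) //= coefXn eqxx big1 ?addr0 ?scale1r // => j ji.
by rewrite coefXn eq_sym (inj_eq val_inj) (negPf ji).
Qed.

End DifferenceOperator.

(** * Sums over the residues modulo p *)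

Section PowerSums.
Variables (R : idomainType) (p : nat) (pcharRp : p \in [pchar R]).

Lemma sum_shift_pchar (f : nat -> R) :
  f p = f 0 -> \sum_(j < p) f j.+1 = \sum_(j < p) f j.
Proof.
move=> fp; apply: (addrI (f 0)).
by rewrite -(big_ord_recl p (fun j => f j)) big_ord_recr /= fp addrC.
Qed.

Lemma natr_inj_pchar : {in gtn p &, injective (fun i => i%:R : R)}.
Proof.
move=> i j; rewrite !inE; wlog ij : i j / (i <= j)%N => [IH|] ip jp eqR.
  by case: (leqP i j) => [|/ltnW] ?; [|apply/esym]; apply: IH.
apply/eqP; rewrite eqn_leq ij /= -subn_eq0.
have: (p %| j - i)%N by rewrite (dvdn_pcharf pcharRp) natrB // eqR subrr.
by case: posnP => // ji /(dvdn_leq ji); rewrite leqNgt (leq_ltn_trans (leq_subr _ _)).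
Qed.

Lemma natrX_pchar i : (i%:R : R) ^+ p = i%:R.
Proof. by rewrite -(pFrobenius_autE pcharRp) rmorph_nat. Qed.

(** As a polynomial in [y], the left-hand side plus [1] has degree less than
    [p].  It vanishes at [0] by Fermat's little theorem and is invariant under
    [y |-> y + 1], hence it has the [p] roots [0, 1, ..., p - 1]. *)
Lemma sum_shiftX_pchar (y : R) : \sum_(j < p) (y + j%:R) ^+ p.-1 = -1.
Proof.
have p_pr := pcharf_prime pcharRp; have p_gt0 := prime_gt0 p_pr.
pose P : {poly R} := \sum_(j < p) ('X + j%:R) ^+ p.-1 + 1.
have PE z : P.[z] = \sum_(j < p) (z + j%:R) ^+ p.-1 + 1.
  rewrite hornerD hornerC horner_sum; congr (_ + 1); apply: eq_bigr => j _.
  by rewrite horner_exp hornerD hornerX -polyC_natr hornerC.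
have P0 : P.[0] = 0.
  have p1_gt0 : (0 < p.-1)%N by rewrite -ltnS prednK ?prime_gt1.
  rewrite PE (bigD1 (Ordinal p_gt0)) //= addr0 expr0n eqn0Ngt p1_gt0 add0r.
  rewrite (eq_bigr (fun=> 1)) => [|j]; last first.
    rewrite -val_eqE /= -lt0n => j_gt0.
    have j0 : (j%:R : R) != 0.
      by rewrite -(dvdn_pcharf pcharRp) gtnNdvd.
    by apply: (mulfI j0); rewrite add0r -exprS prednK // natrX_pchar mulr1.
  by rewrite sumr_const cardC1 card_ord natr1 prednK // (pcharf0 pcharRp).
have Ps i : P.[i.+1%:R] = P.[i%:R].
  rewrite !PE; congr (_ + _).
  rewrite -[RHS](@sum_shift_pchar (fun j => (i%:R + j%:R) ^+ p.-1)).
    by apply: eq_bigr => j _; rewrite -!natrD addSnnS.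
  by rewrite (pcharf0 pcharRp).
have Pi i : P.[i%:R] = 0 by elim: i => // i IHi; rewrite Ps.
have {Pi} P_eq0 : P = 0.
  apply/eqP; apply: contraT => P_neq0; pose rs : seq R := [seq i%:R | i <- iota 0 p].
  have rsP : all (root P) rs by apply/allP => _ /mapP[i _ ->]; apply/eqP.
  have rsU : uniq rs.
    rewrite map_inj_in_uniq ?iota_uniq // => i j.
    by rewrite !mem_iota /= => ? ?; apply: natr_inj_pchar.
  have := max_poly_roots P_neq0 rsP rsU.
  rewrite size_map size_iota ltnNge => /negP[].
  apply: leq_trans (size_polyD _ _) _; rewrite geq_max size_poly1 p_gt0 andbT.
  apply: leq_trans (size_sum _ _ _) _; apply/bigmax_leqP => j _.
  by rewrite -polyC_natr -[_%:P]opprK -polyCN size_exp_XsubC prednK.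
by apply/eqP; rewrite -addr_eq0 -PE P_eq0 horner0.
Qed.

(** This constant is [0] for odd [p] and [1] for [p = 2]; only its invariance
    under Frobenius matters, which treats both cases at once. *)
Definition sum_residues : R := \sum_(j < p) j%:R.

Lemma sum_residuesX : sum_residues ^+ p = sum_residues.
Proof. by rewrite /sum_residues -natr_sum natrX_pchar. Qed.

Lemma sumr_const_pchar (a : R) : \sum_(j < p) a = 0.
Proof. by rewrite sumr_const card_ord mulrn_pchar. Qed.

Lemma exprD_pchar (a b : R) : (a + b) ^+ p = a ^+ p + b ^+ p.
Proof. by rewrite -!(pFrobenius_autE pcharRp) rmorphD. Qed.

Lemma exprN_pchar (a : R) : (- a) ^+ p = - a ^+ p.
Proof. by rewrite -!(pFrobenius_autE pcharRp) rmorphN. Qed.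

(** For odd [p] the exponent is even; for [p = 2] the sign is trivial. *)
Lemma exprN_pchar_pred (a : R) : (- a) ^+ p.-1 = a ^+ p.-1.
Proof.
have p_gt0 := prime_gt0 (pcharf_prime pcharRp).
have [->|a0] := eqVneq a 0; first by rewrite oppr0.
by apply: (mulfI a0); rewrite -[LHS]opprK -mulNr -!exprS prednK // exprN_pchar opprK.
Qed.

(** Write [j = (y + j) - y]: the terms [(y + j)^p = y^p + j] add up to [c], and
    the rest is [- y] times the unweighted sum, which is [-1]. *)
Lemma sum_natr_shiftX_pchar (y : R) :
  \sum_(j < p) j%:R * (y + j%:R) ^+ p.-1 = y + sum_residues.
Proof.
have p_gt0 := prime_gt0 (pcharf_prime pcharRp).
rewrite (eq_bigr (fun j : 'I_p => y ^+ p + j%:R - y * (y + j%:R) ^+ p.-1)).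
  rewrite sumrB big_split /= sumr_const_pchar add0r -mulr_sumr.
  by rewrite sum_shiftX_pchar mulrN1 opprK addrC.
move=> j _; apply/eqP; rewrite -subr_eq opprK -mulrDl [j%:R + y]addrC.
by rewrite -exprS prednK // exprD_pchar natrX_pchar.
Qed.

(** [(x - j)^(2p-1) = (x^p - j) (x - j)^(p-1)] reduces this to the weighted and
    unweighted sums of exponent [p - 1]. *)
Lemma sum_shiftX_double_pchar (x : R) :
  \sum_(j < p) (x - j%:R) ^+ (2 * p).-1 = x - x ^+ p - sum_residues.
Proof.
have p_gt0 := prime_gt0 (pcharf_prime pcharRp).
have -> : (2 * p).-1 = (p + p.-1)%N by rewrite mul2n -addnn -subn1 -addnBA ?subn1.
rewrite (eq_bigr (fun j : 'I_p => x ^+ p * (- x + j%:R) ^+ p.-1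
                                  - j%:R * (- x + j%:R) ^+ p.-1)).
  rewrite sumrB -mulr_sumr sum_shiftX_pchar sum_natr_shiftX_pchar.
  by rewrite mulrN1 opprD opprK addrA [- _ + x]addrC.
move=> j _; rewrite exprD exprD_pchar exprN_pchar natrX_pchar mulrBl.
by rewrite -[in - x + _](opprK j%:R) -opprD exprN_pchar_pred.
Qed.

(** The term [u i] occurs [n - (i + 1)] times. *)
Lemma sum_partial_sums n (u : nat -> R) :
  \sum_(b < n) \sum_(i < b) u i =
  n%:R * (\sum_(i < n) u i) - \sum_(i < n) i.+1%:R * u i.
Proof.
elim: n => [|n IHn]; first by rewrite !big_ord0 mulr0 subr0.
rewrite !big_ord_recr /= IHn mulrDr opprD addrACA subrr addr0.
by rewrite -natr1 mulrDl mul1r addrAC.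
Qed.

Lemma sum_partial_shiftX_pchar (y : R) :
  \sum_(b < p) \sum_(i < b) (y + i%:R) ^+ p.-1 = 1 - y - sum_residues.
Proof.
rewrite (sum_partial_sums _ (fun i => (y + i%:R) ^+ p.-1)).
rewrite (pcharf0 pcharRp) mul0r sub0r.
under eq_bigr => i _ do rewrite -natr1 mulrDl mul1r.
rewrite big_split /= sum_natr_shiftX_pchar sum_shiftX_pchar.
by rewrite opprB -addrA -opprD.
Qed.
End PowerSums.

(** * Differences along a polynomial automorphism *)

Section PolynomialMapsTheory.
Variables (K : fieldType) (n : nat).
Implicit Types (F G : GA K n) (g : {mpoly K[n]}).

Lemma GA_mapM F G : GA_map (F * G)%g = polymap_comp (GA_map F) (GA_map G).
Proof. by []. Qed.

Lemma comp_mpolyGM g F G :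
  g \mPo GA_map (F * G)%g = (g \mPo GA_map F) \mPo GA_map G.
Proof. by rewrite comp_mpoly_polymap_comp. Qed.

Lemma comp_mpolyG1 g : g \mPo GA_map (1%g : GA K n) = g.
Proof. exact: comp_mpoly_id. Qed.

Lemma iter_comp_mpoly F k g :
  iter k (comp_mpoly (GA_map F)) g = g \mPo GA_map (F ^+ k)%g.
Proof.
elim: k => [|k IHk]; first by rewrite expg0 comp_mpolyG1.
by rewrite iterS IHk expgSr comp_mpolyGM.
Qed.

(** Substitution reverses composition, so conjugating by [G] transports [Delta]
    along [g |-> g \mPo G]. *)
Lemma iter_Delta_conj F G m g :
  iter m (Delta (GA_map (G * F * G^-1)%g)) g =
  iter m (Delta (GA_map F)) (g \mPo GA_map G) \mPo GA_map G^-1%g.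
Proof.
elim: m => [|m IHm] /=; first by rewrite -comp_mpolyGM mulgV comp_mpolyG1.
rewrite IHm /Delta comp_mpolyB; congr (_ - _).
by rewrite -!comp_mpolyGM !mulgA mulVg mul1g.
Qed.

Section PCharacteristic.
Variables (p : nat) (pcharKp : p \in [pchar K]).

Lemma iter_Delta_pchar F g :
  iter p (Delta (GA_map F)) g = Delta (GA_map (F ^+ p)%g) g.
Proof. by rewrite [LHS](iter_diff_pchar _ pcharKp) /= iter_comp_mpoly. Qed.

Lemma iter_Delta_pchar_pred F g :
  iter p.-1 (Delta (GA_map F)) g = \sum_(i < p) (g \mPo GA_map (F ^+ i)%g).
Proof.
rewrite [LHS](iter_diff_pchar_pred _ pcharKp) /=.
by apply: eq_bigr => i _; rewrite iter_comp_mpoly.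
Qed.

Lemma iter_Delta_pchar2 F g :
  iter (p ^ 2) (Delta (GA_map F)) g = Delta (GA_map (F ^+ (p ^ 2))%g) g.
Proof.
rewrite iterM (eq_iter (iter_Delta_pchar F)) iter_Delta_pchar.
by rewrite expgM.
Qed.

(** [p^2 - 1 = (p - 1) + (p - 1) p], and the [p]-fold difference of [F] is the
    difference of [F^p]: the trace over [p^2] powers is taken first along [F^p],
    then along [F]. *)
Lemma iter_Delta_pchar2_pred F g :
  iter (p ^ 2).-1 (Delta (GA_map F)) g =
  \sum_(i < p)
     ((\sum_(j < p) (g \mPo GA_map (F ^+ p ^+ j)%g)) \mPo GA_map (F ^+ i)%g).
Proof.
have p_gt0 := prime_gt0 (pcharf_prime pcharKp).
have -> : (p ^ 2).-1 = (p.-1 + p.-1 * p)%N.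
  by case: p p_gt0 => // q _; rewrite -mulnn mulSn.
rewrite iterD iterM (eq_iter (iter_Delta_pchar F)) !iter_Delta_pchar_pred.
by [].
Qed.

End PCharacteristic.

(** * Pascal depth *)

Lemma emin_posP (P : pred nat) d :
  (0 < d)%N -> P d -> (forall m, (0 < m)%N -> P m -> (d <= m)%N) ->
  emin_pos P = Some d.
Proof.
move=> d_gt0 Pd d_min; rewrite /emin_pos; case: pselect => [exP|[]]; last first.
  by exists d; rewrite d_gt0.
case: ex_minnP => m /andP[m_gt0 Pm] m_min; congr Some; apply/eqP.
by rewrite eqn_leq d_min // m_min ?d_gt0.
Qed.

Lemma emin_pos_le (P : pred nat) d :
  (0 < d)%N -> P d -> exists2 m, emin_pos P = Some m & (m <= d)%N.
Proof.
move=> d_gt0 Pd; rewrite /emin_pos; case: pselect => [exP|[]]; last first.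
  by exists d; rewrite d_gt0.
by case: ex_minnP => m _ m_min; exists m; rewrite // m_min ?d_gt0.
Qed.

Lemma iter_Delta_eq0 (F : polymap K n) g m k :
  (m <= k)%N -> iter m (Delta F) g = 0 -> iter k (Delta F) g = 0.
Proof.
move=> /subnK <- eq0; rewrite iterD eq0; elim: (k - m)%N => //= j ->.
by rewrite /Delta comp_mpoly0 subrr.
Qed.

Lemma pascal_depthP (F : polymap K n) d i :
  (forall j, iter d (Delta F) 'X_j = 0) -> iter d.-1 (Delta F) 'X_i != 0 ->
  (0 < d)%N -> pascal_depth F = Some d.
Proof.
move=> Fd Fi d_gt0.
have depth_le j : exists2 m, pascal_depth_at F 'X_j = Some m & (m <= d)%N.
  by apply: emin_pos_le => //; rewrite Fd.
have depth_i : pascal_depth_at F 'X_i = Some d.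
  apply: emin_posP => //= [|m m_gt0 /eqP Fm]; first by rewrite Fd.
  rewrite leqNgt; apply: contra Fi => md; apply/eqP; apply: iter_Delta_eq0 Fm.
  by rewrite -ltnS prednK.
pose f j := odflt 0%N (pascal_depth_at F 'X_j).
have fE j : pascal_depth_at F 'X_j = Some (f j).
  by rewrite /f; have [m ->] := depth_le j.
rewrite /pascal_depth (eq_bigr _ (fun j _ => fE j)).
rewrite -(big_morph Some (op2 := maxn) (id2 := 0%N)) //; congr Some.
apply/eqP; rewrite eqn_leq; apply/andP; split.
  by apply/bigmax_leqP => j _; have [m] := depth_le j; rewrite fE => -[->].
by apply: (@leq_trans (f i)); [rewrite /f depth_i | apply: leq_bigmax].
Qed.

(** If [F = Id + H] then [Delta F 'X_i = H_i]; composing [F^-1 = Id - H] with [F]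
    gives [H \mPo F = H], so a second difference kills [H_i]. *)
Lemma quasi_translation_iter_Delta F i :
  quasi_translation F -> iter 2 (Delta (GA_map F)) 'X_i = 0.
Proof.
case=> H FH; have [Fi _] := FH i.
have XF j : 'X_j \mPo GA_map F = tnth (GA_map F) j.
  by rewrite comp_mpolyXU -tnth_nth.
rewrite /= /Delta XF Fi [_ + _ - _]addrAC subrr add0r.
have [_ ] := FH i => /(congr1 (comp_mpoly (GA_map F))).
rewrite comp_mpolyB XF -[tnth (GA_map F^-1%g) i \mPo _]tnth_polymap_comp.
rewrite -GA_mapM mulVg tnth_mktuple Fi => XE.
apply/eqP; rewrite -oppr_eq0 opprB; apply/eqP/(addrI 'X_i).
by rewrite addr0 addrA -XE.
Qed.

End PolynomialMapsTheory.

(** * The automorphism M and its conjugate *)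

Section Plane.
Variables (K : fieldType) (p : nat) (pcharKp : p \in [pchar K]).
Local Notation x := ('X_ord0 : {mpoly K[2]}).
Local Notation y := ('X_ord_max : {mpoly K[2]}).

Lemma polymap_comp2 (a b : {mpoly K[2]}) (G : polymap K 2) :
  polymap_comp [tuple a; b] G = [tuple a \mPo G; b \mPo G].
Proof.
by apply/eq_from_tnth => i; rewrite tnth_mktuple; case: i => [[|[|]]].
Qed.

Lemma polymap_id2 : polymap_id K 2 = [tuple x; y].
Proof.
apply/eq_from_tnth => i; rewrite tnth_mktuple !(tnth_nth 0).
by case: i => [[|[|]]] //= ?; congr 'X_ _; apply: val_inj.
Qed.

Lemma comp_mpolyXn (a : {mpoly K[2]}) k (F : polymap K 2) :
  (a ^+ k) \mPo F = (a \mPo F) ^+ k.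
Proof. exact: rmorphXn. Qed.

Lemma comp_mpolyNat k (F : polymap K 2) :
  (k%:R : {mpoly K[2]}) \mPo F = k%:R.
Proof. exact: rmorph_nat. Qed.

Let compE := (comp_mpolyD, comp_mpolyN, comp_mpoly1, comp_mpolyXn,
  comp_mpolyNat, comp_mpolyXU).

Let M := M_aut K p.

Let pcharRp : p \in [pchar {mpoly K[2]}].
Proof. by rewrite pchar_lalg. Qed.

Lemma GA_map_M k :
  GA_map (M ^+ k)%g = [tuple x + \sum_(i < k) (y + i%:R) ^+ p.-1; y + k%:R].
Proof.
elim: k => [|k IHk].
  by rewrite expg0 big_ord0 !addr0; apply: polymap_id2.
rewrite expgS GA_mapM IHk [GA_map M]/(M_map K p) /M_map polymap_comp2 !compE /=.
by rewrite big_ord_recr -!addrA [k%:R + 1]natr1 /= [X in x + X]addrC.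
Qed.

Lemma GA_map_Mp k : GA_map (M ^+ p ^+ k)%g = [tuple x - k%:R; y].
Proof.
elim: k => [|k IHk].
  by rewrite expg0 subr0; apply: polymap_id2.
rewrite expgS GA_mapM IHk GA_map_M sum_shiftX_pchar // (pcharf0 pcharRp) addr0.
by rewrite polymap_comp2 !compE /= -natr1 opprD addrA.
Qed.

(** The polynomial is the first component of [S], and the exponent [2p-1] is
    chosen so that both stages of the trace survive: the [x]-translations leave
    [x - x^p - c], additive in [x] up to a constant, whose trace along [M] only
    sees the sum of the translation parts [a i]. *)
Lemma iter_Delta_M :
  iter (p ^ 2).-1 (Delta (GA_map M)) (y + x ^+ (2 * p).-1) = y ^+ p - y.
Proof.
rewrite iter_Delta_pchar2_pred //.
have -> : \sum_(j < p) ((y + x ^+ (2 * p).-1) \mPo GA_map (M ^+ p ^+ j)%g) =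
          x - x ^+ p - sum_residues {mpoly K[2]} p.
  under eq_bigr => j _ do rewrite GA_map_Mp !compE /=.
  by rewrite big_split /= sumr_const_pchar // add0r sum_shiftX_double_pchar.
pose a k := \sum_(i < k) (y + i%:R) ^+ p.-1.
rewrite (eq_bigr (fun i : 'I_p => x - x ^+ p - sum_residues {mpoly K[2]} p
                           + (a i - (a i) ^+ p))); last first.
  move=> i _; rewrite GA_map_M /sum_residues -natr_sum !compE /= -/(a i).
  by rewrite exprD_pchar // opprD [RHS]addrAC addrACA.
rewrite big_split /= sumr_const_pchar // add0r sumrB.
have -> : \sum_(i < p) a i ^+ p = (\sum_(i < p) a i) ^+ p.
  by rewrite -(pFrobenius_autE pcharRp) rmorph_sum.
rewrite sum_partial_shiftX_pchar // !exprD_pchar // !exprN_pchar // expr1n.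
rewrite sum_residuesX // -[_ - _ - sum_residues _ _]addrA -[1 - _ - _]addrA.
by rewrite opprD addrACA subrr add0r !opprD !opprK addrACA addNr addr0 addrC.
Qed.

Lemma expX_pchar_subX_neq0 : y ^+ p - y != 0.
Proof.
have p_gt1 := prime_gt1 (pcharf_prime pcharKp).
rewrite subr_eq0 mpolyXn; apply/eqP => /(congr1 (fun q => q@_(U_(ord_max)))).
rewrite !mcoeffX eqxx; case: eqP => [/(congr1 mdeg)|_ /eqP]; last first.
  by rewrite eq_sym oner_eq0.
by rewrite mdegMn mdeg1 mul1n => p1; rewrite p1 in p_gt1.
Qed.

(** [y |-> y + m] forces [p] to divide [m = k p]; then [M^m] is [x |-> x - k],
    which forces [p] to divide [k]. *)
Lemma M_expg_eq1 m : ((M ^+ m)%g == 1%g) = (p ^ 2 %| m)%N.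
Proof.
have tuple_inj (a b c d : {mpoly K[2]}) :
    [tuple a; b] = [tuple c; d] -> a = c /\ b = d by move/(congr1 val) => [-> ->].
have eq1P k : (M ^+ k)%g = 1%g -> GA_map (M ^+ k)%g = [tuple x; y].
  by move=> ->; apply: polymap_id2.
apply/eqP/idP => [Mm|/dvdnP[k ->]]; last first.
  rewrite mulnC expgM expnS expn1 expgM; have -> : (M ^+ p ^+ p)%g = 1%g.
    apply: GA_inj; rewrite GA_map_Mp (pcharf0 pcharRp) subr0.
    by rewrite -polymap_id2.
  by rewrite expg1n.
have pm : (p %| m)%N.
  have := eq1P m Mm; rewrite GA_map_M => /tuple_inj[_ /eqP].
  by rewrite -subr_eq0 addrAC subrr add0r -(dvdn_pcharf pcharRp).
case/dvdnP: pm Mm => k -> Mm; rewrite expnS expn1 dvdn_mul //.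
have := eq1P _ Mm; rewrite mulnC expgM GA_map_Mp => /tuple_inj[/eqP + _].
by rewrite -subr_eq0 addrAC subrr add0r oppr_eq0 -(dvdn_pcharf pcharRp).
Qed.

Lemma G_expg_eq1 m : ((G_aut K p ^+ m)%g == 1%g) = (p ^ 2 %| m)%N.
Proof.
have -> : G_aut K p = (M ^ (S_aut K p)^-1)%g by rewrite conjgE invgK mulgA.
by rewrite -conjXg conjg_eq1 M_expg_eq1.
Qed.

Lemma iter_Delta_G_eq0 g : iter (p ^ 2) (Delta (GA_map (G_aut K p))) g = 0.
Proof.
rewrite iter_Delta_pchar2 // (eqP (_ : _ ^+ _ == 1)%g) ?G_expg_eq1 ?dvdnn //.
by rewrite /Delta comp_mpolyG1 subrr.
Qed.

Lemma iter_Delta_G_neq0 :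
  iter (p ^ 2).-1 (Delta (GA_map (G_aut K p))) x != 0.
Proof.
apply: contra expX_pchar_subX_neq0 => /eqP.
rewrite iter_Delta_conj comp_mpolyXU /= iter_Delta_M.
move=> /(congr1 (comp_mpoly (GA_map (S_aut K p)))).
by rewrite -comp_mpolyGM mulVg comp_mpolyG1 comp_mpoly0 => ->.
Qed.

End Plane.

(** * Tameness *)

Section Tame.
Variable K : fieldType.
Local Notation x := ('X_ord0 : {mpoly K[2]}).
Local Notation y := ('X_ord_max : {mpoly K[2]}).

Lemma affine_perm n (F : GA K n) (s : 'S_n) (b : 'I_n -> K) :
  (forall i, tnth (GA_map F) i = 'X_(s i) + (b i)%:MP) -> affine F.
Proof.
move=> FE; exists (perm_mx s), b; split=> [|i]; first exact: unitmx_perm.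
rewrite FE (bigD1 (s i)) //= !mxE eqxx scale1r big1 ?addr0 // => j ji.
by rewrite !mxE eq_sym (negPf ji) scale0r.
Qed.

Let compE := (comp_mpolyD, comp_mpolyN, comp_mpoly1, comp_mpolyXn,
  comp_mpolyXU).

Fact shear_subproof k :
  inverse_maps ([tuple x + y ^+ k; y], [tuple x - y ^+ k; y]).
Proof.
rewrite /inverse_maps /= !polymap_comp2 polymap_id2 !compE /=.
by apply/andP; split; apply/eqP/val_inj; rewrite /= !(addrK, subrK).
Qed.
Definition shear k : GA K 2 := MkGA (shear_subproof k).

Fact translation_subproof : inverse_maps ([tuple x; y + 1], [tuple x; y - 1]).
Proof.
rewrite /inverse_maps /= !polymap_comp2 polymap_id2 !compE /=.
by apply/andP; split; apply/eqP/val_inj; rewrite /= !(addrK, subrK).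
Qed.
Definition translation : GA K 2 := MkGA translation_subproof.

Fact swap_subproof : inverse_maps ([tuple y; x], [tuple y; x]).
Proof.
by rewrite /inverse_maps /= !polymap_comp2 polymap_id2 !compE /= eqxx.
Qed.
Definition swap : GA K 2 := MkGA swap_subproof.

Lemma shear_tame k : tame (shear k).
Proof.
apply: generated_in; right; exists ord0, (y ^+ k); split=> [m|].
  by rewrite mpolyXn msuppX inE => /eqP ->; rewrite mulmnE mnm1E.
case=> [[|[|]]] // i; rewrite (tnth_nth 0) //=.
Qed.

Lemma translation_tame : tame translation.
Proof.
apply: generated_in; left.
apply: (@affine_perm _ _ 1%g (fun i => (i == ord_max)%:R)).
case=> [[|[|]]] // i; rewrite (tnth_nth 0) perm1 -val_eqE /= ?addr0 ?mpolyC0 ?addr0.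
  by congr 'X_ _; apply: val_inj.
by congr ('X_ _ + _); apply: val_inj.
Qed.

Lemma swap_tame : tame swap.
Proof.
apply: generated_in; left.
apply: (@affine_perm _ _ (tperm ord0 ord_max) (fun=> 0)).
case=> [[|[|]]] // i; rewrite (tnth_nth 0) mpolyC0 addr0 /=.
  by rewrite (_ : Ordinal i = ord0) ?tpermL //; apply: val_inj.
by rewrite (_ : Ordinal i = ord_max) ?tpermR //; apply: val_inj.
Qed.

Lemma M_aut_tame p : tame (M_aut K p).
Proof.
have -> : M_aut K p = (translation * shear p.-1)%g.
  by apply: GA_inj; rewrite GA_mapM /GA_map /= /M_map polymap_comp2 !compE.
by apply: generated_mul; [apply: translation_tame | apply: shear_tame].
Qed.

Lemma S_aut_tame p : tame (S_aut K p).
Proof.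
have -> : S_aut K p = (shear (2 * p).-1 * swap)%g.
  by apply: GA_inj; rewrite GA_mapM /GA_map /= /S_map polymap_comp2 !compE.
by apply: generated_mul; [apply: shear_tame | apply: swap_tame].
Qed.

Lemma G_aut_tame p : tame (G_aut K p).
Proof.
apply: generated_mul; last exact/generated_inv/S_aut_tame.
by apply: generated_mul; [apply: S_aut_tame | apply: M_aut_tame].
Qed.

End Tame.

Theorem theorem1p2 (K : fieldType) (p : nat) (pcharKp : p \in [pchar K]%R) :
  [/\ tame (G_aut K p),
      ~ quasi_translation (G_aut K p),
      pascal_depth (GA_map (G_aut K p)) = Some (p ^ 2)%N
    & group_order (G_aut K p) = Some (p ^ 2)%N].
Proof.
have p_gt1 := prime_gt1 (pcharf_prime pcharKp).
have p2_gt0 : (0 < p ^ 2)%N by rewrite expn_gt0 ltnW.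
have D_neq0 := iter_Delta_G_neq0 pcharKp.
split.
- exact: G_aut_tame.
- move=> /(quasi_translation_iter_Delta ord0) D2.
  case/eqP: D_neq0; apply: iter_Delta_eq0 D2.
  by rewrite -ltnS prednK // (@leq_trans (2 ^ 2)) // leq_exp2r.
- apply: (@pascal_depthP _ _ _ _ ord0) => // i.
  exact: iter_Delta_G_eq0.
- apply: emin_posP => //= [|m m_gt0]; rewrite (G_expg_eq1 pcharKp) //.
  exact: dvdn_leq.
Qed.
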